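(* There exist games with no deception bonus: there exists a finite two-player normal-form game such that, for every number of rounds $T\ge 1$, the deception bonus of player $A$ in the $T$-round repeated game against $\mathsf{ERM}$ equals $0$.
   Context: Setting. A two-player normal-form game is repeated for $T$ rounds. Player $A$ (the optimizer, row player) has a finite action set $\mathcal{A}$, player $B$ (the opponent, column player) has a finite action set $\mathcal{B}$, with utilities $u^A,u^B:\mathcal{A}\times\mathcal{B}\to\mathbb{R}$ received once per round. Empirical Risk Minimization ($\mathsf{ERM}$): in round $t$, when player $A$ has played $a_1,\dots,a_{t-1}$, player $B$ plays $\mathsf{ERM}([a_1,\dots,a_{t-1}])=\arg\max_{b\in\mathcal{B}}\sum_{i=1}^{t-1}u^B(a_i,b)$, ties broken in favour of the leftmost action in a fixed order on $\mathcal{B}$ (in round 1 all actions are tied). Deception bonus. Let $\mathbf{a}\in\Delta(\mathcal{A})$ be a Stackelberg leader strategy for $A$: a mixed strategy maximizing $A$'s expected utility against the best response of $B$, where $B$'s best response to $\mathbf{a}$ is $\mathbf{b}\in\arg\max_{b\in\mathcal{B}}\mathbb{E}_{a'\sim\mathbf{a}}[u^B(a',b)]$ (ties among best responses in this one-shot benchmark are broken in favour of $A$). The deception bonus is $$\Big[\max_{(a_t)_{t=1}^T\in\mathcal{A}^T}\sum_{t=1}^T u^A(a_t,b_t)\Big]-T\cdot\mathbb{E}_{a'\sim\mathbf{a}}[u^A(a',\mathbf{b})],\qquad b_t=\mathsf{ERM}([a_1,\dots,a_{t-1}]).$$ *)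

(* Defs.v *)
From HB Require Import structures.
From mathcomp Require Import all_boot all_order all_algebra.
From mathcomp Require Import reals.

Set Implicit Arguments.
Unset Strict Implicit.
Unset Printing Implicit Defensive.

Import Order.TTheory GRing.Theory Num.Theory.
Local Open Scope ring_scope.

(* [actB] carries the total order in which ties are broken ("leftmost" is least);
   [actA0] and the bottom of [actB] make both action sets nonempty. *)
Record game (R : realType) := Game {
  actA : finType;
  actA0 : actA;
  dispB : Order.disp_t;
  actB : finTBOrderType dispB;
  uA : actA -> actB -> R;
  uB : actA -> actB -> R
}.

Section Deception.
Variables (R : realType) (G : game R).
Implicit Types (h : seq (actA G)) (b : actB G) (a : {ffun actA G -> R}).

Definition argmax (f : actB G -> R) : {set actB G} :=
  [set b | [forall b', f b' <= f b]].

(* The element [arg max f] is only a witness that [argmax f] is nonempty. *)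
Definition leftmost_argmax (f : actB G -> R) : actB G :=
  [arg min_(b < [arg max_(b > \bot) f b]%O in argmax f) b]%O.

Definition erm h : actB G := leftmost_argmax (fun b => \sum_(x <- h) uB x b).

(* Rounds are numbered from 0: the move in round [t] is [tnth s t], and the
   history before it is [take t s]. *)
Definition payoff T (s : T.-tuple (actA G)) : R :=
  \sum_(t < T) uA (tnth s t) (erm (take t s)).

(* The default element of the [max] is the payoff of the constant play [actA0],
   itself one of the values over which the maximum is taken. *)
Definition max_payoff T : R :=
  \big[Num.max/payoff (nseq_tuple T (actA0 G))]_(s : T.-tuple (actA G)) payoff s.

Definition mixed a : Prop :=
  (forall x, 0 <= a x) /\ \sum_x a x = 1.

Definition expect a (u : actA G -> actB G -> R) b : R := \sum_x a x * u x b.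

Definition best_responses a : {set actB G} := argmax (expect a (@uB R G)).

(* Among the best responses to [a], one that is best for the leader. *)
Definition best_response a : actB G :=
  [arg max_(b > [arg max_(b > \bot) expect a (@uB R G) b] in best_responses a)
     expect a (@uA R G) b]%O.

Definition commit_value a : R := expect a (@uA R G) (best_response a).

Definition stackelberg a : Prop :=
  mixed a /\ forall a', mixed a' -> commit_value a' <= commit_value a.

Definition deception_bonus a T : R := max_payoff T - T%:R * commit_value a.

End Deception.

(* Main.v *)
Require Import Defs.
From mathcomp Require Import all_boot all_order all_algebra.
From mathcomp Require Import reals.

Set Implicit Arguments.
Unset Strict Implicit.
Unset Printing Implicit Defensive.

Import Order.TTheory GRing.Theory Num.Theory.
Local Open Scope ring_scope.

(** In the coordination game [uA = uB = (a == b)], committing to the leftmost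
    action yields the largest entry [1] of the payoff matrix.  Playing that
    action in every round also yields [1] per round, because it is the one that
    ERM selects in the opening tie and a best response to every later history.
    No strategy can do better in either setting. *)

Lemma leftmost_argmax_bot (R : realType) (G : game R) (f : actB G -> R) :
  (forall b, f b <= f \bot%O) -> leftmost_argmax f = \bot%O.
Proof.
move=> fbot; have arg_bot : \bot%O \in argmax f by rewrite inE; apply/forallP.
rewrite /leftmost_argmax; case: Order.TotalTheory.arg_minP => [|b _ min_b].
  rewrite inE; case: Order.TotalTheory.arg_maxP => // b _ max_b.
  by apply/forallP => b'; exact: max_b.
by apply/eqP; rewrite -lex0; exact: min_b.
Qed.

(** Ties are broken in the leader's favour, so one known best response bounds the commitment value
    from below without computing [best_response]. *)
Lemma best_responseP (R : realType) (G : game R) (a : {ffun actA G -> R}) b :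
  b \in best_responses a -> expect a (@uA R G) b <= commit_value a.
Proof.
rewrite /commit_value /best_response => br_b.
case: Order.TotalTheory.arg_maxP => [|b' _]; last exact.
rewrite inE; case: Order.TotalTheory.arg_maxP => // b0 _ max_b0.
by apply/forallP => b'; exact: max_b0.
Qed.

Lemma expect_le (R : realType) (G : game R) (a : {ffun actA G -> R})
    (u : actA G -> actB G -> R) M b :
  mixed a -> (forall x y, u x y <= M) -> expect a u b <= M.
Proof.
move=> [a_ge0 a_sum1] leM; rewrite -[M]mul1r -a_sum1 mulr_suml.
by apply: ler_sum => x _; rewrite ler_wpM2l.
Qed.

Lemma payoff_le (R : realType) (G : game R) M T (s : T.-tuple (actA G)) :
  (forall x y, @uA R G x y <= M) -> payoff s <= T%:R * M.
Proof.
move=> leM; rewrite mulr_natl -[in leRHS](card_ord T) -sumr_const.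
by apply: ler_sum => t _; exact: leM.
Qed.

(** In the order on [bool], [false] is the bottom, hence the leftmost reply. Choosing it as [actA0]
    too makes the default play in [max_payoff] the optimal constant play. *)
Definition coordination (R : realType) : game R :=
  @Game R bool false _ bool (fun a b => (a == b)%:R) (fun a b => (a == b)%:R).

Section Coordination.
Variable R : realType.
Let G := coordination R.

Definition commit_left : {ffun actA G -> R} := [ffun x => (x == false)%:R].

Lemma uA_coordination_le1 x y : @uA R G x y <= 1.
Proof. by rewrite /= lern1; case: (_ == _). Qed.

Lemma mixed_commit_left : mixed commit_left.
Proof.
split=> [x|]; first by rewrite ffunE ler0n.
by rewrite big_bool /= !ffunE add0r.
Qed.

Lemma expect_commit_left u b : expect commit_left u b = u false b.
Proof. by rewrite /expect big_bool /= !ffunE mul0r mul1r add0r. Qed.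

Lemma commit_left_value : 1 <= commit_value commit_left.
Proof.
suff br : false \in best_responses commit_left.
  by apply: le_trans (best_responseP br); rewrite expect_commit_left.
rewrite inE; apply/forallP => b; rewrite !expect_commit_left.
(* [uA] and [uB] coincide, and their entry at [false], [false] computes to [1]. *)
exact: uA_coordination_le1.
Qed.

Lemma stackelberg_commit_left : stackelberg commit_left.
Proof.
split=> [|a mixed_a]; first exact: mixed_commit_left.
apply: le_trans commit_left_value.
exact: expect_le mixed_a uA_coordination_le1.
Qed.

(** Stackelberg strategies are not unique here (committing to [true] is optimal too), but the upper
    bound [1] and comparison with [commit_left] pin their common value. *)
Lemma stackelberg_value (a : {ffun actA G -> R}) :
  stackelberg a -> commit_value a = 1.
Proof.
case=> mixed_a max_a; apply/le_anti/andP; split.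
  exact: expect_le mixed_a uA_coordination_le1.
exact: le_trans commit_left_value (max_a _ mixed_commit_left).
Qed.

(** On a history of [false] only, the reply [false] is best term by term; [n = 0] is the opening
    tie, where all sums are empty. *)
Lemma erm_nseq_left n : erm (nseq n false : seq (actA G)) = false.
Proof.
apply: leftmost_argmax_bot => b; rewrite !big_seq.
by apply: ler_sum => x /nseqP[-> _]; exact: uA_coordination_le1.
Qed.

Lemma payoff_nseq_left T : payoff (nseq_tuple T (actA0 G)) = T%:R.
Proof.
rewrite /payoff (eq_bigr (fun=> 1)) ?sumr_const ?card_ord // => t _.
rewrite (tnth_nth false) /= nth_nseq ltn_ord.
by rewrite take_nseq ?erm_nseq_left // ltnW.
Qed.

Lemma max_payoff_coordination T : max_payoff G T = T%:R.
Proof.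
rewrite /max_payoff payoff_nseq_left; apply/le_anti/andP; split.
  apply/bigmax_leP; split=> // s _; rewrite -[leRHS]mulr1.
  exact: payoff_le uA_coordination_le1.
(* The default of the maximum, the constant play of [actA0], already attains [T]. *)
exact: bigmax_ge_id.
Qed.

End Coordination.

Theorem proposition3 (R : realType) :
  exists G : game R,
    (exists a : {ffun actA G -> R}, stackelberg a) /\
    (forall a : {ffun actA G -> R}, stackelberg a ->
       forall T : nat, (1 <= T)%N -> deception_bonus a T = 0).
Proof.
exists (coordination R); split.
  by exists (commit_left R); exact: stackelberg_commit_left.
move=> a st_a T _.
by rewrite /deception_bonus max_payoff_coordination stackelberg_value // mulr1 subrr.
Qed.
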